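(* Let $S$ be a permutative semigroup. (1) Let $\{A_i,\ i\in I\}$ be a family of subsets of $S$ such that $A=\bigcap_{i\in I}Sep(A_i)$ is not empty. Then $P_{\{A_i,\ i\in I\}}$ is a monoid congruence of $S$, and $A$ is a $P_{\{A_i,\ i\in I\}}$-class which is the identity element of the factor semigroup $S/P_{\{A_i,\ i\in I\}}$. (2) Conversely, for every monoid congruence $\sigma$ of $S$ there is a family $\{A_i,\ i\in I\}$ of subsets of $S$ such that $\bigcap_{i\in I}Sep(A_i)\neq\emptyset$ and $\sigma=P_{\{A_i,\ i\in I\}}$.
   Context: A semigroup $S$ is called permutative if it satisfies a non-trivial permutation identity, that is, there are a positive integer $n\geq 2$ and a non-identity permutation $\pi$ of $\{1,2,\dots,n\}$ such that $x_1x_2\cdots x_n=x_{\pi(1)}x_{\pi(2)}\cdots x_{\pi(n)}$ for all $x_1,\dots,x_n\in S$. For a subset $A$ of a semigroup $S$, let $\overline{A}=S\setminus A$. The separator $Sep(A)$ of $A$ is the set of all $x\in S$ such that $xA\subseteq A$, $Ax\subseteq A$, $x\overline{A}\subseteq\overline{A}$ and $\overline{A}x\subseteq\overline{A}$. For a family $\{A_i,\ i\in I\}$ of subsets of $S$, the relation $P_{\{A_i,\ i\in I\}}$ on $S$ is defined by: $(a,b)\in P_{\{A_i,\ i\in I\}}$ if and only if, for every $i\in I$ and all $x,y\in S$, $xay\in A_i\Leftrightarrow xby\in A_i$. (This relation is a congruence of $S$.) A congruence $\sigma$ of $S$ is called a monoid congruence if the factor semigroup $S/\sigma$ is a monoid,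 i.e. has an identity element. *)

(* Defs.v *)
From HB Require Import structures.
From mathcomp Require Import all_boot perm.
From mathcomp Require Import boolp classical_sets.

Set Implicit Arguments.
Unset Strict Implicit.
Unset Printing Implicit Defensive.

Local Open Scope group_scope.
Local Open Scope classical_set_scope.
Local Open Scope quotient_scope.

(* x_0 x_1 ... x_n: a semigroup need not have a unit, so \prod is not available. *)
Definition sprod (S : semigroupType) (n : nat) (x : 'I_n.+1 -> S) : S :=
  foldl (fun p i => p * x (lift ord0 i)) (x ord0) (enum 'I_n).

(* The length of the identity is n.+2, that is, any integer >= 2. *)
Definition permutative (S : semigroupType) : Prop :=
  exists (n : nat) (p : 'S_n.+2), p <> 1 /\
    forall x : 'I_n.+2 -> S, sprod x = sprod (fun i => x (p i)).

Definition separator (S : semigroupType) (A : set S) : set S :=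
  [set x | [/\ [set x * a | a in A] `<=` A,
               [set a * x | a in A] `<=` A,
               [set x * b | b in ~` A] `<=` ~` A &
               [set b * x | b in ~` A] `<=` ~` A]].

Record congruence (S : semigroupType) := Congruence {
  cong_rel :> S -> S -> Prop;
  cong_refl : forall a, cong_rel a a;
  cong_sym : forall a b, cong_rel a b -> cong_rel b a;
  cong_trans : forall a b c, cong_rel a b -> cong_rel b c -> cong_rel a c;
  cong_mull : forall x a b, cong_rel a b -> cong_rel (x * a) (x * b);
  cong_mulr : forall x a b, cong_rel a b -> cong_rel (a * x) (b * x)
}.

Section Factor.
Variables (S : semigroupType) (s : congruence S).

Definition cong_bool : rel S := fun a b => `[< s a b >].

Lemma cong_bool_refl : reflexive cong_bool.
Proof. by move=> a; apply/asboolP/cong_refl. Qed.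

Lemma cong_bool_sym : symmetric cong_bool.
Proof. by move=> a b; apply/asboolP/asboolP => /cong_sym. Qed.

Lemma cong_bool_trans : transitive cong_bool.
Proof.
by move=> b a c /asboolP ab /asboolP bc; apply/asboolP; apply: cong_trans bc.
Qed.

Canonical cong_equiv := EquivRel cong_bool
  cong_bool_refl cong_bool_sym cong_bool_trans.

Definition factor := {eq_quot cong_bool}.

HB.instance Definition _ : EqQuotient S cong_bool factor := EqQuotient.on factor.
HB.instance Definition _ := Choice.on factor.

Lemma pi_factorP a b : \pi_factor a = \pi_factor b <-> s a b.
Proof.
split=> [/eqP|s_ab]; first by rewrite eqquotE => /asboolP.
by apply/eqP; rewrite eqquotE; apply/asboolP.
Qed.

Definition factor_mul (p q : factor) : factor := \pi_factor (repr p * repr q).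

Lemma factor_mul_pi a b :
  factor_mul (\pi_factor a) (\pi_factor b) = \pi_factor (a * b).
Proof.
apply/pi_factorP; have reprs c : s (repr (\pi_factor c)) c.
  by apply/pi_factorP; rewrite reprK.
by apply: cong_trans (cong_mull _ (reprs b)); apply: cong_mulr.
Qed.

Lemma factor_mulA : associative factor_mul.
Proof.
move=> p q r; rewrite -[p]reprK -[q]reprK -[r]reprK.
by rewrite !factor_mul_pi mulgA !reprK.
Qed.

HB.instance Definition _ := isSemigroup.Build factor factor_mulA.

Definition factor_class (q : factor) : set S := [set a | \pi_factor a = q].

End Factor.

Definition is_identity (S : semigroupType) (e : S) : Prop :=
  left_id e *%g /\ right_id e *%g.

Definition monoid_congruence (S : semigroupType) (s : congruence S) : Prop :=
  exists e : factor s, is_identity e.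

Section FamilyCongruence.
Variables (S : semigroupType) (I : Type) (A_ : I -> set S).

Definition family_rel (a b : S) : Prop :=
  forall (i : I) (x y : S), A_ i (x * a * y) <-> A_ i (x * b * y).

Lemma family_rel_refl a : family_rel a a.
Proof. by []. Qed.

Lemma family_rel_sym a b : family_rel a b -> family_rel b a.
Proof. by move=> ab i x y; rewrite ab. Qed.

Lemma family_rel_trans a b c :
  family_rel a b -> family_rel b c -> family_rel a c.
Proof. by move=> ab bc i x y; rewrite ab. Qed.

Lemma family_rel_mull z a b : family_rel a b -> family_rel (z * a) (z * b).
Proof. by move=> ab i x y; rewrite !mulgA; apply: ab. Qed.

Lemma family_rel_mulr z a b : family_rel a b -> family_rel (a * z) (b * z).
Proof. by move=> ab i x y; rewrite !mulgA -!(mulgA _ z); apply: ab. Qed.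

Definition family_cong : congruence S := Congruence family_rel_refl
  family_rel_sym family_rel_trans family_rel_mull family_rel_mulr.

End FamilyCongruence.

(* Main.v *)
(** If [s] lies in the separator of [A], then factors [s] at either end of a
    product do not affect membership in [A].  A non-trivial permutation inverts
    two consecutive letters; substituting [x] and [y] for them and [s] for all
    other letters, the permutation identity yields
    [x y \in A <-> y s^q x \in A] with a fixed [q], for all [x] and [y].
    Replacing [y] by [s y] does not change the right-hand side, so
    [x s y \in A <-> x y \in A]: factors from the separator can be dropped
    inside a product too. *)
Require Import Defs.
From mathcomp Require Import all_boot perm.
From mathcomp Require Import boolp classical_sets.

Set Implicit Arguments.
Unset Strict Implicit.

Local Open Scope classical_set_scope.

(** The two inclusions for the complement are the contrapositives of the implications from the
    product back to [z]. *)
Lemma separatorP (S : semigroupType) (A : set S) (s : S) :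
  separator A s <->
  forall z, (A (s * z)%g <-> A z) /\ (A (z * s)%g <-> A z).
Proof.
split=> [[sA As sC Cs] z | inv].
  split; split=> Az.
  - by apply: contrapT => nAz; apply: (sC (s * z)%g) => //; exists z.
  - by apply: sA; exists z.
  - by apply: contrapT => nAz; apply: (Cs (z * s)%g) => //; exists z.
  - by apply: As; exists z.
split=> _ [z Az <-].
- exact: (inv z).1.2.
- exact: (inv z).2.2.
- by move=> /(inv z).1.1.
- by move=> /(inv z).2.1.
Qed.

Lemma foldl_mulg (S : semigroupType) (u v : S) (w : seq S) :
  foldl *%g (u * v)%g w = (u * foldl *%g v w)%g.
Proof. by elim: w v => //= c w IHw v; rewrite -mulgA IHw. Qed.

(** An extra [s] in front serves as the starting value of the fold, so the first letter needs no
    separate treatment; for [s] in the separator of [A] it does not affect membership in [A]. *)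
Lemma mulg_sprod (S : semigroupType) (n : nat) (s : S) (x : 'I_n.+1 -> S) :
  (s * sprod x)%g = foldl *%g s [seq x i | i <- enum 'I_n.+1].
Proof.
rewrite enum_ordSl /= foldl_mulg -map_comp /sprod; congr (_ * _)%g.
by elim: (enum 'I_n) (x ord0) => //= i l IHl u; rewrite IHl.
Qed.

(** Otherwise the values of [p] increase strictly from each position to the next, which forces [p]
    to be the identity. *)
Lemma perm_adjacent_inversion (n : nat) (p : 'S_n.+1) :
  p <> 1%g ->
  exists a b : 'I_n.+1, b = a.+1 :> nat /\ p b < p a.
Proof.
move=> p_neq1; apply: contrapT => noinv; apply: p_neq1.
have srt : sorted ltn [seq val (p i) | i <- enum 'I_n.+1].
  apply/(sortedP 0) => i; rewrite size_map size_enum_ord /= => lt_i.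
  rewrite (nth_map ord0) ?size_enum_ord ?(ltnW lt_i) //.
  rewrite [ltnRHS](nth_map ord0) ?size_enum_ord //.
  set a := nth _ _ i; set b := nth _ _ i.+1.
  have [Ea Eb] : a = i :> nat /\ b = i.+1 :> nat by rewrite /a /b !nth_enum_ord // ltnW.
  case: (ltngtP (p a) (p b)) => // [lt_ba | /val_inj/perm_inj eq_ab].
    by case: noinv; exists a, b; rewrite Eb Ea.
  by move: Eb; rewrite -eq_ab Ea => /n_Sn.
(* A strictly increasing list is determined by its set of entries, and by surjectivity of [p] these
   are all numbers below [n.+1]. *)
have Eiota : [seq val (p i) | i <- enum 'I_n.+1] = iota 0 n.+1.
  apply: (irr_sorted_eq ltn_trans ltnn srt (iota_ltn_sorted _ _)) => k.
  rewrite mem_iota add0n /=; apply/mapP/idP => [[i _ ->] // | lt_k].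
  by exists (p^-1%g (Ordinal lt_k)); rewrite ?mem_enum // permKV.
apply/permP => i; rewrite perm1; apply: val_inj.
move: Eiota; rewrite -val_enum_ord => /eq_in_map -> //.
by rewrite mem_enum.
Qed.

Section Separator.
Variables (S : semigroupType) (A : set S) (s : S).
Hypothesis sep_s : separator A s.

Let sepl z : A (s * z)%g <-> A z. Proof. exact: ((separatorP _ _).1 sep_s z).1. Qed.
Let sepr z : A (z * s)%g <-> A z. Proof. exact: ((separatorP _ _).1 sep_s z).2. Qed.

(** This is [z s^q], written as an iteration because [q] may be zero and a semigroup has no
    [s^0]. *)
Local Notation mulrs q := (iter q (fun z : S => (z * s)%g)).

Lemma mulrs_mulg q u v : mulrs q (u * v)%g = (u * mulrs q v)%g.
Proof. by elim: q => //= q ->; rewrite mulgA. Qed.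

Lemma foldl_mulg_nseq q u : foldl *%g u (nseq q s) = mulrs q u.
Proof. by elim: q u => //= q IHq u; rewrite IHq -iterSr. Qed.

Lemma separator_word x y n q r :
  A (foldl *%g s (nseq n s ++ x :: nseq q s ++ y :: nseq r s)) <->
  A (mulrs q x * y)%g.
Proof.
rewrite foldl_cat /= foldl_cat /= !foldl_mulg_nseq.
have strip_r z : A (mulrs r z) <-> A z.
  by elim: r => //= m IHm; rewrite sepr.
have strip_l z : A (mulrs n s * z)%g <-> A z.
  elim: n z => [|m IHm] z /=; first exact: sepl.
  by rewrite -mulgA IHm sepl.
by rewrite strip_r mulrs_mulg -mulgA strip_l.
Qed.

(** Only the letters [s] between [x] and [y] survive. Their number [q] is fixed before [x], [y] and
    [f], so that one exponent serves all substitutions. *)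
Lemma separator_two_letters (T : eqType) (l : seq T) (a b : T) :
  uniq l -> b \in l -> index a l < index b l ->
  exists2 q, (index b l = index a l + q.+1)%N &
  forall x y f, f a = x -> f b = y ->
    (forall c, c != a -> c != b -> f c = s) ->
    (A (foldl *%g s (map f l)) <-> A (mulrs q x * y)%g).
Proof.
move=> l_uniq bl lt_ab.
have al : a \in l by rewrite -index_mem (ltn_trans lt_ab) // index_mem.
have nba : b != a by apply: contraTneq lt_ab => ->; rewrite ltnn.
case/splitPr: al l_uniq bl lt_ab => l1 l'.
rewrite cat_uniq /= negb_or => /and3P[_ /andP[al1 _] /andP[al' l'_uniq]].
rewrite mem_cat inE (negPf nba) /= !index_cat (negPf al1) /= eqxx addn0.
case: ifP => [bl1 _|/negbT bl1 /= bl' _].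
  by rewrite ltnNge ltnW // index_mem.
case/splitPr: bl' al' l'_uniq => l2 l3.
rewrite mem_cat inE !negb_or cat_uniq /= negb_or.
move=> /and3P[al2 _ al3] /and3P[_ /andP[bl2 _] /andP[bl3 _]].
exists (size l2).
  by rewrite eq_sym (negPf nba) index_cat (negPf bl2) /= eqxx addn0.
move=> x y f <- <- fs.
have nseqf l0 : a \notin l0 -> b \notin l0 -> map f l0 = nseq (size l0) s.
  move=> al0 bl0; rewrite -(size_map f); apply/all_pred1P/allP => _ /mapP[c cl0 ->].
  apply/eqP/fs; first by apply: contraNneq al0 => <-.
  by apply: contraNneq bl0 => <-.
rewrite map_cat /= map_cat /= !nseqf //; exact: separator_word.
Qed.

Lemma separator_permutative :
  permutative S -> forall x y, A (x * s * y)%g <-> A (x * y)%g.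
Proof.
move=> [n [p [p_neq1 permS]]].
(* The inverse is taken because the letter [c] stands at position [p^-1 c] in the permuted word: [b]
   comes right after [a] on the left-hand side of the identity and before [a] on the right. *)
have [] := @perm_adjacent_inversion _ (p^-1)%g.
  by move=> pV1; apply: p_neq1; rewrite -[p]invgK pV1 invg1.
move=> a [b [Eb lt_ba]].
pose l := enum 'I_n.+2; pose lp := map p l.
have indexl c : index c l = c by exact: index_enum_ord.
have indexlp c : index c lp = (p^-1)%g c.
  by rewrite -{1}[c](permKV p) index_map ?indexl //; exact: perm_inj.
have lp_mem c : c \in lp.
  by rewrite -[c](permKV p) map_f // mem_enum.
have [|||q Eq wl] := @separator_two_letters _ l a b.
- exact: enum_uniq.
- exact: mem_enum.
- by rewrite !indexl Eb.
have [|||r _ wlp] := @separator_two_letters _ lp b a.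
- by rewrite map_inj_uniq ?enum_uniq //; exact: perm_inj.
- exact: lp_mem.
- by rewrite !indexlp.
(* On the left-hand side [a] and [b] are adjacent, so no [s] separates them. *)
have q0 : q = 0.
  by move: Eq; rewrite !indexl Eb -addn1 => /addnI [].
have nba : b != a by apply: contra_eq_neq Eb => ->; rewrite neq_ltn ltnSn.
have swap x y : A (x * y)%g <-> A (mulrs r y * x)%g.
  pose f c := if c == a then x else if c == b then y else s.
  have fa : f a = x by rewrite /f eqxx.
  have fb : f b = y by rewrite /f (negPf nba) eqxx.
  have fs c : c != a -> c != b -> f c = s.
    by rewrite /f => /negPf -> /negPf ->.
  have := wl x y f fa fb fs; rewrite q0 /= => <-.
  rewrite -(wlp y x f fb fa) => [|c cb ca]; last exact: fs.
  by rewrite /lp -(map_comp f p) -!mulg_sprod permS.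
by move=> x y; rewrite -mulgA (swap x (s * y)%g) mulrs_mulg -mulgA sepl (swap x y).
Qed.

End Separator.

Section FamilyMonoid.
Variables (S : semigroupType) (I : Type) (A_ : I -> set S) (e : S).
Hypotheses (permS : permutative S) (sep_e : (\bigcap_i separator (A_ i)) e).

Let sep_ei i : separator (A_ i) e. Proof. exact: sep_e. Qed.

Lemma family_rel_identity a :
  family_rel A_ (e * a)%g a /\ family_rel A_ (a * e)%g a.
Proof.
split=> i x y.
  by rewrite mulgA -!(mulgA _ a y) (separator_permutative (sep_ei i)).
by rewrite mulgA (separator_permutative (sep_ei i)).
Qed.

Lemma family_rel_separator b :
  family_rel A_ b e <-> (\bigcap_i separator (A_ i)) b.
Proof.
split=> [be i _ | sep_b i x y]; last first.
  by rewrite (separator_permutative (sep_b i Logic.I)) // (separator_permutative (sep_ei i)).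
have sepe z := (separatorP _ _).1 (sep_ei i) z.
apply/separatorP => z; split.
  (* [family_rel] compares [b] with [e] only between two factors, so an outer [e] is added first to
     supply the missing one. *)
  by rewrite -(sepe (b * z)%g).1 mulgA be -mulgA !(sepe _).1.
by rewrite -(sepe (z * b)%g).2 be !(sepe _).2.
Qed.

End FamilyMonoid.

Theorem theorem2 (S : semigroupType) (permS : permutative S) :
  (forall (I : Type) (A_ : I -> set S),
     let A := \bigcap_i separator (A_ i) in
     A !=set0 ->
     monoid_congruence (family_cong A_) /\
     exists e : factor (family_cong A_), is_identity e /\ factor_class e = A)
  /\
  (forall s : congruence S, monoid_congruence s ->
     exists (I : Type) (A_ : I -> set S),
       \bigcap_i separator (A_ i) !=set0 /\
       cong_rel s = family_rel A_).
Proof.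
split=> [I A_ A [e sep_e] | s [E [E1l E1r]]].
  set s := family_cong A_.
  have id_e : is_identity (\pi_(factor s) e)%qT.
    split=> q; rewrite -[q]reprK [LHS](factor_mul_pi s); apply/pi_factorP.
      exact: (family_rel_identity permS sep_e _).1.
    exact: (family_rel_identity permS sep_e _).2.
  split; exists (\pi_(factor s) e)%qT => //; split=> //.
  apply/seteqP; split=> b; rewrite /factor_class /= pi_factorP.
    by move/(family_rel_separator permS sep_e).
  by move=> sep_b; apply/(family_rel_separator permS sep_e).
pose e := repr E.
have sl a : s (e * a)%g a.
  apply/pi_factorP; rewrite -factor_mul_pi /e reprK; exact: E1l.
have sr a : s (a * e)%g a.
  apply/pi_factorP; rewrite -factor_mul_pi /e reprK; exact: E1r.
(* The family consists of all classes of [s], indexed by representatives. Multiplication by [e]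
   preserves every class, so [e] lies in all separators. *)
exists S, (fun c => [set a | s a c]); split.
  exists e => c _; apply/separatorP => z /=; split; split=> sz.
  - exact: cong_trans (cong_sym (sl z)) sz.
  - exact: cong_trans (sl z) sz.
  - exact: cong_trans (cong_sym (sr z)) sz.
  - exact: cong_trans (sr z) sz.
apply/funext => a; apply/funext => b; apply/propext; split=> [ab c x y /= | ab].
  have xy : s (x * a * y)%g (x * b * y)%g by apply/cong_mulr/cong_mull.
  by split; apply: cong_trans => //; apply: cong_sym.
have se z : s (e * z * e)%g z by exact: cong_trans (sr _) (sl _).
apply: cong_trans (cong_sym (se a)) _.
(* In the context [e _ e], the class of [b] contains [e * b * e], hence also [e * a * e]. *)
by apply/(ab b e e); apply: se.
Qed.
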